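(* Let $\varepsilon<\frac{3}{10}\left(1-\sqrt{\tfrac12\log\tfrac43}\right)$ be a constant (logarithms base $2$). Then there is a constant $c(\varepsilon)>0$, depending only on $\varepsilon$, such that for every $k\ge 1$ we have $\operatorname{IC}_\varepsilon(\operatorname{AND}_k;\vec Z\mid D)\ge c(\varepsilon)/k$.
   Context: $\operatorname{AND}_k:\{0,1\}^k\to\{0,1\}$ is the Boolean conjunction of $k$ bits. The random variables $\vec Z=(Z_1,\dots,Z_k)\in\{0,1\}^k$ and $D\in\{1,\dots,k\}$ are distributed as follows. $D$ is uniform on $\{1,\dots,k\}$. Given $D=i$, we have $Z_j=0$ for all $j\ne i$, and $Z_i$ is a uniform bit. Protocols are randomized $k$-party protocols in the number in the hand model: player $i$ knows only the $i$-th input bit and has private random bits independent of the inputs, and the players write to a shared blackboard. The transcript $M(\vec z)$ is the final blackboard content on input $\vec z$; it is a random variable determined by the input and the random bits. A protocol is an $\varepsilon$-error protocol for $\operatorname{AND}_k$ if on every input its output (inferable from the transcript) differs from $\operatorname{AND}_k$ with probability at most $\varepsilon$. The conditional information cost of a protocol $P$ is $\operatorname{icost}(P;\vec Z\mid D)=\operatorname{I}(M(\vec Z):\vec Z\mid D)$, the conditional mutual information, where the protocol's random bits are independent of $(\vec Z,D)$. The conditional $\varepsilon$-error information complexity $\operatorname{IC}_\varepsilon(\operatorname{AND}_k;\vec Z\mid D)$ is the minimum of $\operatorname{icost}(P;\vec Z\mid D)$ over all randomized $\varepsilon$-error protocols $P$ for $\operatorname{AND}_k$. *)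

(* Defs.v *)
From HB Require Import structures.
From mathcomp Require Import all_boot all_order all_algebra.
From mathcomp Require Import classical_sets reals constructive_ereal ereal exp.

Set Implicit Arguments.
Unset Strict Implicit.
Unset Printing Implicit Defensive.
Import Order.TTheory GRing.Theory Num.Theory.

Local Open Scope ring_scope.

Definition log2 (R : realType) (x : R) : R := ln x / ln 2.

(** Discrete probability on a finite sample space [O] with mass function [P].
    Random variables are functions on [O]; they may take values in an infinite
    type, so sums over values range over the (finite) image. *)

Definition is_pmf (R : realType) (O : finType) (P : O -> R) : Prop :=
  (forall w, 0 <= P w) /\ \sum_w P w = 1.

Definition Pr (R : realType) (O : finType) (P : O -> R) (A : pred O) : R :=
  \sum_(w | A w) P w.

Definition condPr (R : realType) (O : finType) (P : O -> R) (A B : pred O) : R :=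
  Pr P [pred w | A w && B w] / Pr P B.

Definition values (O : finType) (T : eqType) (X : O -> T) : seq T :=
  undup (codom X).

(* H(X | B) for an event B; [ln 0 = 0] gives the convention 0 log 0 = 0. *)
Definition entropy_given (R : realType) (O : finType) (P : O -> R)
    (T : eqType) (X : O -> T) (B : pred O) : R :=
  - \sum_(x <- values X)
      condPr P [pred w | X w == x] B * log2 (condPr P [pred w | X w == x] B).

(* H(X | Y) *)
Definition cond_entropy (R : realType) (O : finType) (P : O -> R)
    (T U : eqType) (X : O -> T) (Y : O -> U) : R :=
  \sum_(y <- values Y)
     Pr P [pred w | Y w == y] * entropy_given P X [pred w | Y w == y].

(* I(X : Y | Z) = H(X | Z) - H(X | Y, Z) *)
Definition cond_mutual_info (R : realType) (O : finType) (P : O -> R)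
    (T U V : eqType) (X : O -> T) (Y : O -> U) (Z : O -> V) : R :=
  cond_entropy P X Z - cond_entropy P X (fun w => (Y w, Z w)).

(** Randomized [k]-party number-in-the-hand protocols. *)

Definition input (k : nat) : finType := {ffun 'I_k -> bool}.

(* The node reached in the tree is the current blackboard content.  At
   [Speak i msg t0 t1] player [i], knowing only its own input bit and its own
   [m] private random bits, appends one bit to the blackboard; the protocol
   continues with [t0] if that bit is 0 and with [t1] if it is 1. *)
Inductive ptree (k m : nat) : Type :=
| Halt : ptree k m
| Speak : 'I_k -> (bool -> m.-tuple bool -> bool) ->
          ptree k m -> ptree k m -> ptree k m.

Fixpoint board (k m : nat) (t : ptree k m) (z : input k)
    (r : {ffun 'I_k -> m.-tuple bool}) : seq bool :=
  match t with
  | Halt => [::]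
  | Speak i msg t0 t1 =>
      let b := msg (z i) (r i) in
      b :: (if b then board t1 z r else board t0 z r)
  end.

(* Each player's string of random bits may have an arbitrary distribution (fair
   coins being one instance).  Messages of a protocol of bounded length depend
   on only finitely many events of a player's private randomness, so this also
   accounts for players holding infinitely many fair coins. *)
Record protocol (R : realType) (k : nat) : Type := Protocol {
  nbits : nat;
  coins : 'I_k -> nbits.-tuple bool -> R;
  coins_pmf : forall i, is_pmf (coins i);
  tree : ptree k nbits;
  output : seq bool -> bool
}.
Arguments coins {R k} p i.
Arguments output {R k} p.

Definition transcript (R : realType) (k : nat) (p : protocol R k) (z : input k)
    (r : {ffun 'I_k -> (nbits p).-tuple bool}) : seq bool :=
  board (tree p) z r.

(* Joint law of the private random strings: independent across players. *)
Definition coins_law (R : realType) (k : nat) (p : protocol R k)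
    (r : {ffun 'I_k -> (nbits p).-tuple bool}) : R :=
  \prod_i coins p i (r i).

Definition eps_error (R : realType) (k : nat) (eps : R) (f : input k -> bool)
    (p : protocol R k) : Prop :=
  forall z : input k,
    Pr (@coins_law R k p) [pred r | output p (transcript z r) != f z] <= eps.

(* I(M(Z) : Z | D) for (Z, D) of law [nu], independent of the random bits. *)
Definition icost (R : realType) (k : nat) (nu : input k * 'I_k -> R)
    (p : protocol R k) : R :=
  @cond_mutual_info R
    ((input k * 'I_k) * {ffun 'I_k -> (nbits p).-tuple bool})%type
    (fun w => nu w.1 * coins_law w.2) _ _ _
    (fun w => transcript w.1.1 w.2) (fun w => w.1.1) (fun w => w.1.2).

(* Infimum in the extended reals: it is +oo when no protocol has error eps
   (i.e. when eps < 0). *)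
Definition IC (R : realType) (k : nat) (eps : R) (f : input k -> bool)
    (nu : input k * 'I_k -> R) : \bar R :=
  ereal_inf [set (icost nu p)%:E | p in [set p | eps_error eps f p]]%classic.

Definition AND (k : nat) (z : input k) : bool := [forall i, z i].

(* D is uniform; given D = i, every Z_j with j != i is 0 and Z_i is a fair bit. *)
Definition ZD_law (R : realType) (k : nat) (zd : input k * 'I_k) : R :=
  k%:R^-1 * (if [forall j, (j != zd.2) ==> ~~ zd.1 j] then 2^-1 else 0).

Lemma ZD_law_pmf (R : realType) (k : nat) (hk : (1 <= k)%N) :
  is_pmf (@ZD_law R k).
Proof.
split=> [[z d]|].
  by rewrite /ZD_law mulr_ge0 ?invr_ge0 ?ler0n //; case: ifP; rewrite ?invr_ge0.
rewrite -(pair_bigA _ (fun z d => ZD_law R (z, d))) exchange_big /=.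
rewrite (eq_bigr (fun=> k%:R^-1)) => [|d _].
  by rewrite sumr_const card_ord -[LHS]mulr_natr mulVf // pnatr_eq0 -lt0n.
pose e (b : bool) : input k := [ffun j => (j == d) && b].
rewrite /ZD_law -mulr_sumr -big_mkcond /=.
rewrite (reindex_onto e (fun z => z d)) => [|z /forallP hz]; last first.
  apply/ffunP => j; rewrite ffunE; have := hz j.
  by case: eqVneq => [->|_] //= /negbTE ->.
rewrite (eq_bigl xpredT) => [|b]; last first.
  rewrite ffunE eqxx /= eqxx andbT.
  by apply/forallP => j; apply/implyP => /negbTE jd; rewrite ffunE jd.
rewrite big_bool /= -[X in _ = X]mulr1; congr (_ * _).
by rewrite -[X in X + _]mul1r -[X in _ + X]mul1r -mulrDl mulfV ?pnatr_eq0.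
Qed.

(* Main.v *)
(** The probability of a transcript [t] on input [z] factors over the players;
    let [X_z] be the square root of this probability mass function, a unit vector,
    so that [<X_y, X_z>] is a Bhattacharyya coefficient. With [e_i] the i-th unit
    input, conditioning on [D = i] makes the information cost a Jensen-Shannon
    divergence, at least half of [d_i = 1 - <X_0, X_(e_i)>]; hence k times the
    information cost is at least [(\sum_i d_i) / 2].

    A lower bound for [\sum_i d_i] comes from uniformly random inputs [z]:
    the average of [X_z] is a product of midpoints, whose ratio to [X_0] is
    at least 1/2 in each coordinate, and this gives
    [E_z <X_0, X_z> >= 1 - 3/2 \sum_i d_i]. As [X_z X_(~z) = X_0 X_1] pointwise,
    averaging [|X_z + X_(~z) - 2 X_0|^2 >= 0] over [z] gives
    [<X_0, X_1> >= 1 - 6 \sum_i d_i]. A protocol of error eps has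
    [<X_0, X_1> <= 2 eps + 1/2], which is smaller than 1 because the hypothesis
    forces [eps < 1/4]. *)
Require Import Defs.
From mathcomp Require Import all_boot all_order all_algebra.
From mathcomp Require Import classical_sets reals constructive_ereal ereal sequences exp.
From mathcomp Require Import ring lra.
Import Order.TTheory GRing.Theory Num.Theory.

Local Open Scope ring_scope.

(** * Pointwise inequalities for products and logarithms *)

(** The tangent bound at [- w / (1 + w)], inverted, gives [expR (w / (1 + w)) <= 1 + w]; the rest is
    [w ^+ 2 * (1 + 2 * w) >= 0]. *)
Lemma expR_quadratic_le (R : realType) (w : R) :
  - (1 / 2) <= w -> expR (w - 2 * w ^+ 2) <= 1 + w.
Proof.
move=> hw; have w1 : 0 < 1 + w by lra.
have h : w - 2 * w ^+ 2 <= w / (1 + w).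
  by rewrite ler_pdivlMr //; have := sqr_ge0 w; nra.
apply: (@le_trans _ _ (expR (w / (1 + w)))); first by rewrite ler_expR.
rewrite -[leLHS]invrK -expRN -[leRHS]invrK lef_pV2 ?posrE ?expR_gt0 ?invr_gt0 //.
apply: le_trans (expR_ge1Dx _).
by rewrite le_eqVlt; apply/orP; left; apply/eqP; field; rewrite gt_eqF.
Qed.

(** A Weierstrass product inequality for mixed signs, at the price of a quadratic term. *)
Lemma prod_1D_ge (R : realType) (I : finType) (w : I -> R) :
  (forall i, - (1 / 2) <= w i) ->
  1 + \sum_i (w i - 2 * w i ^+ 2) <= \prod_i (1 + w i).
Proof.
move=> hw; apply: le_trans (expR_ge1Dx _) _.
rewrite expR_sum; apply: ler_prod => i _.
by rewrite expR_ge0 expR_quadratic_le.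
Qed.

(* The pointwise form of a bound on the Bhattacharyya coefficient of inputs 0 and
   a uniformly random z, linear in those of 0 and the unit inputs. With
   [w i = (b i / a i - 1) / 2 >= - 1/2], the combination [w - 2 w^2] only
   contains [b/a] and [(b/a)^2], whose averages are Bhattacharyya coefficients
   and total masses. *)
Lemma prod_midpoint_ge (R : realType) (I : finType) (a b : I -> R)
    (x : R) (y : I -> R) :
  (forall i, 0 <= a i) -> (forall i, 0 <= b i) ->
  x = \prod_i a i ->
  (forall i, y i = \prod_j (if j == i then b j else a j)) ->
  x ^+ 2 + \sum_i (3 / 2 * (x * y i - x ^+ 2) - 1 / 2 * (y i ^+ 2 - x ^+ 2))
    <= x * \prod_i ((a i + b i) / 2).
Proof.
move=> ha hb xP yP.
(* Ratios [b i / a i] require [x != 0]; for [x = 0] the left-hand side is at most 0. *)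
have [x0|xN0] := eqVneq x 0.
  rewrite x0 expr0n mul0r add0r /=.
  apply: sumr_le0 => i _; have := sqr_ge0 (y i); lra.
have aN0 i : a i != 0.
  apply: contra_neq xN0 => ai0.
  by rewrite xP (bigD1 i) //= ai0 mul0r.
pose w i := (b i / a i - 1) / 2.
have hw i : - (1 / 2) <= w i.
  have : 0 <= b i / a i by rewrite divr_ge0.
  rewrite /w; lra.
have yE i : y i = x * (b i / a i).
  rewrite yP xP (bigD1 i) //= eqxx [in RHS](bigD1 i) //=.
  rewrite (eq_bigr a) => [|j /negbTE -> //].
  by field; exact: aN0.
have -> : \prod_i ((a i + b i) / 2) = x * \prod_i (1 + w i).
  rewrite xP -big_split; apply: eq_bigr => i _ /=.
  by rewrite /w; field; exact: aN0.
rewrite mulrA -expr2.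
apply: le_trans (ler_wpM2l (sqr_ge0 x) (prod_1D_ge _ _ w hw)).
rewrite mulrDr mulr1 mulr_sumr le_eqVlt.
apply/orP; left; apply/eqP; congr (_ + _).
by apply: eq_bigr => i _; rewrite yE /w; field; exact: aN0.
Qed.

Lemma ln2_le1 (R : realType) : ln 2 <= 1 :> R.
Proof. by have -> : 2 = 1 + 1 :> R by []; apply: le_ln1Dx; lra. Qed.

(* The left-hand side is half the density of the squared Hellinger distance, the
   right-hand side that of the Jensen-Shannon divergence. The proof bounds each
   logarithm of a ratio through [ln x = 2 ln (sqrt x)] and [ln x <= x - 1]. *)
Lemma jensen_shannon_ge (R : realType) (a b : R) : 0 <= a -> 0 <= b ->
  (Num.sqrt a - Num.sqrt b) ^+ 2 / 4 <=
    (a * log2 a + b * log2 b) / 2 - (a + b) / 2 * log2 ((a + b) / 2).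
Proof.
move=> a0 b0; set m := (a + b) / 2.
have m0 : 0 <= m by rewrite /m; lra.
have [mE|mN0] := eqVneq m 0.
  have aE : a = 0 by move: mE; rewrite /m; lra.
  have bE : b = 0 by move: mE; rewrite /m; lra.
  by rewrite mE aE bE !mul0r subrr expr0n /= addr0 !mul0r subrr.
have mp : 0 < m by rewrite lt_def mN0.
have key (c : R) : 0 <= c -> 2 * c - 2 * (Num.sqrt c * Num.sqrt m) <= c * (ln c - ln m).
  move=> c0; have [->|cN0] := eqVneq c 0; first by rewrite sqrtr0 !(mul0r,mulr0) subrr.
  have cp : 0 < c by rewrite lt_def cN0.
  have sc : 0 < Num.sqrt c by rewrite sqrtr_gt0.
  have sm : 0 < Num.sqrt m by rewrite sqrtr_gt0.
  have lnsq (x : R) : 0 < x -> ln x = 2 * ln (Num.sqrt x).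
    move=> xp; rewrite -[in LHS](sqr_sqrtr (ltW xp)) lnXn ?sqrtr_gt0 //.
    by rewrite mulr_natl.
  rewrite (lnsq c) // (lnsq m) // -mulrBr.
  have q0 : 0 < Num.sqrt m / Num.sqrt c by rewrite divr_gt0.
  have : ln (Num.sqrt m / Num.sqrt c) <= Num.sqrt m / Num.sqrt c - 1.
    by rewrite -[in leLHS](subrKC 1 (_ / _)) le_ln1Dx //; lra.
  rewrite ln_div ?posrE // => h.
  have -> : Num.sqrt c * Num.sqrt m = c * (Num.sqrt m / Num.sqrt c).
    rewrite -[X in _ = X * _](sqr_sqrtr c0); field; exact: lt0r_neq0.
  nra.
have ln2 : 0 < ln 2 :> R by rewrite ln_gt0 // ltr1n.
have ln21 := ln2_le1 R.
have /= ha := key a a0; have /= hb := key b b0.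
have h4 : (Num.sqrt a - Num.sqrt b) ^+ 2 / 4 <=
    (a * (ln a - ln m) + b * (ln b - ln m)) / 2.
  move: ha hb; have := sqr_sqrtr a0; have := sqr_sqrtr b0; have := sqr_sqrtr m0.
  have : 0 < Num.sqrt m by rewrite sqrtr_gt0.
  have := sqrtr_ge0 a; have := sqrtr_ge0 b.
  move: (Num.sqrt a) (Num.sqrt b) (Num.sqrt m) => p q n p0 q0 n0 nE qE pE ha hb.
  have pqn : p ^+ 2 + q ^+ 2 = 2 * n ^+ 2 by rewrite nE qE pE /m; lra.
  have le_n : p + q <= 2 * n.
    rewrite -(ler_pXn2r (n := 2)) ?nnegrE //; [|lra|lra].
    have := sqr_ge0 (p - q); nra.
  (* By [pqn] both sides have the factor [2 * n - (p + q)], with cofactors [(2 * n + (p + q)) / 4]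
     and [n]. *)
  have : (p - q) ^+ 2 / 4 <= p ^+ 2 + q ^+ 2 - n * (p + q) by nra.
  lra.
have -> : (a * log2 a + b * log2 b) / 2 - m * log2 m =
    (a * (ln a - ln m) + b * (ln b - ln m)) / 2 / ln 2.
  by rewrite /log2 /m; field; exact: lt0r_neq0.
apply: (le_trans h4); rewrite ler_pdivlMr //.
apply: ler_piMr => //; move: h4; have := sqr_ge0 (Num.sqrt a - Num.sqrt b); lra.
Qed.

(** * Overlaps of product amplitudes *)

Definition indicator {k} (A : pred 'I_k) : input k := [ffun i => A i].

(* When [s t i b ^+ 2] is the factor of player [i], holding bit [b], in the
   probability of the transcript [t], this is the square root of the probability
   of [t] on input [z]. *)
Definition amplitude {R : realType} {k : nat} {T : Type}
  (s : T -> 'I_k -> bool -> R) (t : T) (z : input k) : R := \prod_i s t i (z i).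

Lemma overlap_zero_one_ge (R : realType) (k : nat) (T : Type) (r : seq T)
    (s : T -> 'I_k -> bool -> R) :
  (forall t i b, 0 <= s t i b) ->
  (forall z, \sum_(t <- r) amplitude s t z ^+ 2 = 1) ->
  1 - 6 * \sum_i (1 - \sum_(t <- r) amplitude s t (indicator pred0)
                                    * amplitude s t (indicator (pred1 i)))
    <= \sum_(t <- r) amplitude s t (indicator pred0) * amplitude s t (indicator predT).
Proof.
move=> s0; set X := amplitude s => X1.
set z0 := indicator pred0; set z1 := indicator predT.
set del := \sum_i _; set BC := \sum_(t <- r) _.
pose c (z : input k) : input k := [ffun i => ~~ z i].
have cK : involutive c by move=> z; apply/ffunP => i; rewrite !ffunE negbK.
pose N : R := #|{: input k}|%:R.
have N0 : 0 < N by rewrite ltr0n; apply/card_gt0P; exists z0.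
have NE : N = \prod_(i < k) 2.
  by rewrite prodr_const /N card_ffun card_bool card_ord natrX.
pose G := \sum_(z : input k) \sum_(t <- r) X t z0 * X t z.
have hG : N * (1 - 3 / 2 * del) <= G.
  pose q t := X t z0 ^+ 2 +
    \sum_i (3 / 2 * (X t z0 * X t (indicator (pred1 i)) - X t z0 ^+ 2)
            - 1 / 2 * (X t (indicator (pred1 i)) ^+ 2 - X t z0 ^+ 2)).
  have hpt t : q t <= (\sum_(z : input k) X t z0 * X t z) / N.
    rewrite -mulr_sumr -(bigA_distr_bigA (s t)) /= -mulrA NE -prodf_div.
    under [in leRHS]eq_bigr => i _ do rewrite big_bool /= addrC.
    apply: prod_midpoint_ge => // [|i]; rewrite /X /amplitude; apply: eq_bigr => j _.
      by rewrite ffunE.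
    by rewrite ffunE /=; case: (j == i).
  have : \sum_(t <- r) q t <= G / N.
    rewrite /G exchange_big mulr_suml; apply: ler_sum => t _; exact: hpt.
  rewrite ler_pdivlMr // mulrC; apply: le_trans.
  rewrite ler_pM2l // big_split X1 /= lerD2l exchange_big /= mulr_sumr -sumrN.
  apply: ler_sum => i _.
  (* All total masses are 1, so the quadratic terms cancel. *)
  rewrite sumrB -!mulr_sumr !sumrB !X1 subrr mulr0 subr0; lra.
have hz z : 0 <= \sum_(t <- r) (X t z + X t (c z) - 2 * X t z0) ^+ 2.
  by apply: sumr_ge0 => t _; exact: sqr_ge0.
(* cut and paste: the two products contain the same factors *)
have hBC z : \sum_(t <- r) X t z * X t (c z) = BC.
  apply: eq_bigr => t _; rewrite /X /amplitude -!big_split; apply: eq_bigr => i _ /=.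
  by rewrite !ffunE /=; case: (z i) => //=; rewrite mulrC.
have hz' z : 0 <= 6 + 2 * BC - 4 * (\sum_(t <- r) X t z0 * X t z)
                   - 4 * (\sum_(t <- r) X t z0 * X t (c z)).
  apply: le_trans (hz z) _.
  rewrite (eq_bigr (fun t => X t z ^+ 2 + X t (c z) ^+ 2 + 4 * X t z0 ^+ 2
    + 2 * (X t z * X t (c z)) - 4 * (X t z0 * X t z) - 4 * (X t z0 * X t (c z)))).
    by rewrite !(sumrB, big_split) /= -!mulr_sumr !X1 hBC; lra.
  by move=> t _; ring.
have : 0 <= N * (6 + 2 * BC) - 4 * G - 4 * G.
  have GE : G = \sum_z \sum_(t <- r) X t z0 * X t (c z).
    by rewrite /G (reindex_inj (can_inj cK)).
  have : 0 <= \sum_(z : input k) (6 + 2 * BC - 4 * (\sum_(t <- r) X t z0 * X t z)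
      - 4 * (\sum_(t <- r) X t z0 * X t (c z))).
    by apply: sumr_ge0 => z _; exact: hz'.
  by rewrite !sumrB -!mulr_sumr -GE sumr_const -[(_ + _) *+ _]mulr_natl.
(* Inserting [hG] leaves [0 <= N * (2 * BC - 2 + 12 * del)]. *)
move=> h; rewrite -(ler_pM2l N0); nra.
Qed.

(** * Product laws and the rectangle property *)

Lemma Pr_ge0 (R : realType) (O : finType) (P : O -> R) (A : pred O) :
  is_pmf P -> 0 <= Pr P A.
Proof. by move=> [P0 _]; apply: sumr_ge0. Qed.

Lemma sum_Pr_eq (R : realType) (O : finType) (P : O -> R) (T : eqType)
    (X : O -> T) (r : seq T) (A : pred T) :
  uniq r -> (forall w, X w \in r) ->
  \sum_(x <- r | A x) Pr P [pred w | X w == x] = Pr P [pred w | A (X w)].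
Proof.
move=> ur Xr; rewrite /Pr (exchange_big_dep (fun w => A (X w))) /=; last first.
  by move=> x w Ax /eqP ->.
apply: eq_bigr => w Aw; rewrite big_mkcond (bigD1_seq (X w)) //= Aw eqxx /=.
by rewrite big1 ?addr0 // => x /negbTE; rewrite eq_sym => ->; rewrite andbF.
Qed.

Lemma prod_pmf (R : realType) (I J : finType) (Q : I -> J -> R) :
  (forall i, is_pmf (Q i)) -> is_pmf (fun f : {ffun I -> J} => \prod_i Q i (f i)).
Proof.
move=> hQ; split=> [f|]; first by apply: prodr_ge0 => i _; exact: (hQ i).1.
by rewrite -bigA_distr_bigA big1 // => i _; exact: (hQ i).2.
Qed.

Lemma Pr_prod (R : realType) (I J : finType) (Q : I -> J -> R) (A : I -> pred J) :
  Pr (fun f : {ffun I -> J} => \prod_i Q i (f i))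
     [pred f : {ffun I -> J} | [forall i, A i (f i)]]
  = \prod_i Pr (Q i) (A i).
Proof.
under [RHS]eq_bigr => i _ do rewrite /Pr big_mkcond.
rewrite bigA_distr_bigA /Pr big_mkcond; apply: eq_bigr => f _ /=.
case: ifPn => [/forallP hf|]; first by apply: eq_bigr => i _; rewrite hf.
by rewrite negb_forall => /existsP[i /negbTE hi]; rewrite (bigD1 i) //= hi mul0r.
Qed.

(* Whether player [i], with bit [b] and random string [rho], writes as [tau]
   prescribes each time it speaks; that [tau] is a full path of [t] is also required. *)
Fixpoint consistent {k m : nat} (t : ptree k m) (tau : seq bool) (i : 'I_k)
    (b : bool) (rho : m.-tuple bool) : bool :=
  match t, tau with
  | Halt, _ => tau == [::]
  | Speak _ _ _ _, [::] => false
  | Speak j msg t0 t1, c :: tau' =>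
      ((j == i) ==> (msg b rho == c))
      && consistent (if c then t1 else t0) tau' i b rho
  end.

(** The rectangle property: a transcript imposes a separate condition on each player. If [tau] is
    not a full path, some player must exist to violate its condition, hence [0 < k]. *)
Lemma board_eq (k m : nat) (t : ptree k m) (tau : seq bool) (z : input k)
    (r : {ffun 'I_k -> m.-tuple bool}) : (0 < k)%N ->
  (board t z r == tau) = [forall i, consistent t tau i (z i) (r i)].
Proof.
move=> k0; elim: t tau => [|j msg t0 IH0 t1 IH1] [|c tau] /=.
- by apply/esym/forallP.
- by apply/esym/negbTE; rewrite negb_forall; apply/existsP; exists (Ordinal k0).
- by apply/esym/negbTE; rewrite negb_forall; apply/existsP; exists (Ordinal k0).
rewrite eqseq_cons; case: (eqVneq (msg (z j) (r j)) c) => [e|ne] /=.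
  rewrite e.
  have -> : (if c then board t1 z r else board t0 z r) = board (if c then t1 else t0) z r.
    by case: (c).
  have -> : (board (if c then t1 else t0) z r == tau) =
      [forall i, consistent (if c then t1 else t0) tau i (z i) (r i)].
    by case: (c); [exact: IH1 | exact: IH0].
  apply: eq_forallb => i; case: eqVneq => [<-|] //=.
  by rewrite e eqxx.
apply/esym/negbTE; rewrite negb_forall; apply/existsP; exists j.
by rewrite eqxx (negbTE ne).
Qed.

(** * Information cost as a sum of divergences *)

Lemma cond_entropy_prod (R : realType) (A B U : finType) (T : eqType)
    (nu : A -> R) (Q : B -> R) (X : A * B -> T) (g : A -> U) :
  is_pmf Q ->
  cond_entropy (fun w => nu w.1 * Q w.2) X (fun w => g w.1) =
  - \sum_u (\sum_(a | g a == u) nu a) * \sum_(x <- values X)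
      (let c := (\sum_(a | g a == u) nu a * Pr Q [pred b | X (a, b) == x])
                / \sum_(a | g a == u) nu a in c * log2 c).
Proof.
move=> [Q0 Q1]; set P := fun w : A * B => _.
have PrE u (E : A -> pred B) :
    Pr P [pred w | E w.1 w.2 && (g w.1 == u)] =
    \sum_(a | g a == u) nu a * Pr Q (E a).
  under [RHS]eq_bigr => a _ do rewrite /Pr mulr_sumr.
  by rewrite pair_big_dep; apply: eq_bigl => w; rewrite /= andbC.
have PrU u : Pr P [pred w | g w.1 == u] = \sum_(a | g a == u) nu a.
  rewrite (_ : Pr P _ = Pr P [pred w | xpredT w.2 && (g w.1 == u)]) //.
  rewrite (PrE u (fun=> xpredT)); apply: eq_bigr => a _.
  by rewrite /Pr Q1 mulr1.
have -> : cond_entropy P X (fun w => g w.1) = \sum_u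
    Pr P [pred w | g w.1 == u] * entropy_given P X [pred w | g w.1 == u].
  rewrite /cond_entropy big_uniq ?undup_uniq //= big_mkcond; apply: eq_bigr => u _.
  case: ifPn => //; rewrite mem_undup => hu.
  rewrite /Pr big_pred0 ?mul0r // => w /=; apply: contraNF hu => /eqP <-.
  exact: (codom_f (fun w => g w.1)).
rewrite -sumrN; apply: eq_bigr => u _; rewrite PrU /entropy_given mulrN.
congr (- (_ * _)); apply: eq_bigr => x _.
rewrite /condPr PrU -(PrE u (fun a b => X (a, b) == x)) /=.
set p := Pr P _; set q := Pr P _.
suff -> : p = q by [].
by apply: eq_bigl => -[].
Qed.

Lemma sum_ZD_law (R : realType) (k : nat) (d : 'I_k) (g : input k -> R) :
  \sum_z ZD_law R (z, d) * g z =
  k%:R^-1 * ((g (indicator pred0) + g (indicator (pred1 d))) / 2).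
Proof.
pose e (b : bool) : input k := [ffun j => (j == d) && b].
rewrite /ZD_law.
under eq_bigr => z _ do rewrite -mulrA.
rewrite -mulr_sumr; congr (_ * _).
rewrite (bigID (fun z : input k => [forall j, (j != d) ==> ~~ z j])) /=.
rewrite [X in _ + X]big1 ?addr0 => [|z /negbTE ->]; last by rewrite mul0r.
rewrite (reindex_onto e (fun z => z d)) => [|z /forallP hz]; last first.
  apply/ffunP => j; rewrite ffunE; have := hz j.
  by case: eqVneq => [->|_] //= /negbTE ->.
have eP b : [forall j, (j != d) ==> ~~ e b j].
  by apply/forallP => j; apply/implyP => /negbTE jd; rewrite ffunE jd.
rewrite (eq_bigl xpredT) => [|b]; last by rewrite eP ffunE eqxx /= eqxx.
have e0 : e false = indicator pred0 by apply/ffunP => j; rewrite !ffunE andbF.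
have e1 : e true = indicator (pred1 d) by apply/ffunP => j; rewrite !ffunE andbT.
by rewrite big_bool /= !eP e0 e1; lra.
Qed.

Definition transcript_pr {R : realType} {k : nat} (p : protocol R k) (z : input k)
  (t : seq bool) : R := Pr (@coins_law R k p) [pred r | @transcript R k p z r == t].

(** One list for all inputs, taken over the sample space of [icost] so that it is the list its
    entropies sum over. *)
Definition transcripts {R : realType} {k : nat} (p : protocol R k) : seq (seq bool) :=
  values (fun w : (input k * 'I_k) * {ffun 'I_k -> (nbits p).-tuple bool} =>
            @transcript R k p w.1.1 w.2).

Lemma coins_law_pmf (R : realType) (k : nat) (p : protocol R k) :
  is_pmf (@coins_law R k p).
Proof. exact: prod_pmf (coins_pmf p). Qed.

Lemma mem_transcripts (R : realType) (k : nat) (p : protocol R k)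
    (z : input k) (r : {ffun 'I_k -> (nbits p).-tuple bool}) :
  (0 < k)%N -> transcript z r \in transcripts p.
Proof.
move=> k0; rewrite mem_undup.
exact: (codom_f (fun w : (input k * 'I_k) * {ffun 'I_k -> (nbits p).-tuple bool} =>
            @transcript R k p w.1.1 w.2) ((z, Ordinal k0), r)).
Qed.

Lemma sum_transcript_pr (R : realType) (k : nat) (p : protocol R k)
    (z : input k) (A : pred (seq bool)) : (0 < k)%N ->
  \sum_(t <- transcripts p | A t) transcript_pr p z t =
  Pr (@coins_law R k p) [pred r | A (@transcript R k p z r)].
Proof.
move=> k0; apply: sum_Pr_eq; first exact: undup_uniq.
by move=> r; exact: mem_transcripts.
Qed.

(** Given [D = d], the transcript follows the mixture [(a + b) / 2]; given the input too, it follows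
    [a] or [b], each with weight 1/2. *)
Lemma icost_ZD_law (R : realType) (k : nat) (p : protocol R k) : (0 < k)%N ->
  icost (@ZD_law R k) p = k%:R^-1 * \sum_d \sum_(t <- transcripts p)
    (let a := transcript_pr p (indicator pred0) t in
     let b := transcript_pr p (indicator (pred1 d)) t in
     (a * log2 a + b * log2 b) / 2 - (a + b) / 2 * log2 ((a + b) / 2)).
Proof.
move=> k0; rewrite /icost /cond_mutual_info.
have k_neq0 : k%:R != 0 :> R by rewrite pnatr_eq0 -lt0n.
pose xlog (x : R) := x * log2 x.
pose X (w : (input k * 'I_k) * {ffun 'I_k -> (nbits p).-tuple bool}) :=
  @transcript R k p w.1.1 w.2.
have fstD (d : 'I_k) (g : input k -> R) :
    \sum_(a : input k * 'I_k | a.2 == d) ZD_law R a * g a.1 =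
    k%:R^-1 * ((g (indicator pred0) + g (indicator (pred1 d))) / 2).
  rewrite -sum_ZD_law big_mkcond.
  rewrite -(pair_bigA _ (fun z e => if e == d then ZD_law R (z, e) * g z else 0)) /=.
  by apply: eq_bigr => z _; rewrite -big_mkcond big_pred1_eq.
have fstD1 (d : 'I_k) : \sum_(a : input k * 'I_k | a.2 == d) ZD_law R a = k%:R^-1.
  transitivity (\sum_(a : input k * 'I_k | a.2 == d) ZD_law R a * 1).
    by apply: eq_bigr => a _; rewrite mulr1.
  by rewrite (fstD d (fun=> 1)); field.
rewrite (cond_entropy_prod _ _ _ _ _ _ _ X (fun a => a.2) (coins_law_pmf _ _ p)).
rewrite (cond_entropy_prod _ _ _ _ _ _ _ X (fun a => (a.1, a.2)) (coins_law_pmf _ _ p)).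
rewrite -[values X]/(transcripts p).
set S2 := (X in _ - (- X)).
have -> : S2 = k%:R^-1 * \sum_d \sum_(t <- transcripts p)
    ((xlog (transcript_pr p (indicator pred0) t) +
      xlog (transcript_pr p (indicator (pred1 d)) t)) / 2).
  transitivity (\sum_(a : input k * 'I_k) ZD_law R a *
      \sum_(t <- transcripts p) xlog (transcript_pr p a.1 t)).
    apply: eq_bigr => a _.
    have uE (b : input k * 'I_k) : ((b.1, b.2) == a) = (b == a) by case: b.
    rewrite (big_pred1 a) //.
    (* Pairs of mass 0 contribute nothing; otherwise the mass cancels in the conditional
       probability. *)
    have [->|h] := eqVneq (ZD_law R a) 0; first by rewrite !mul0r.
    congr (_ * _); apply: eq_bigr => t _; rewrite !(big_pred1 a) //=.
    by rewrite [ZD_law R a * _]mulrC mulfK.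
  rewrite -(pair_bigA _ (fun z d => ZD_law R (z, d) *
      \sum_(t <- transcripts p) xlog (transcript_pr p z t))) exchange_big /= mulr_sumr.
  apply: eq_bigr => d _; rewrite sum_ZD_law -big_split /= mulr_suml.
  by congr (_ * _); apply: eq_bigr => t _.
rewrite opprK addrC -sumrN mulr_sumr mulr_sumr -big_split; apply: eq_bigr => d _ /=.
rewrite fstD1 -mulrN -mulrDr; congr (_ * _).
rewrite sumrB; congr (_ - _); apply: eq_bigr => t _.
rewrite (fstD d (fun z => transcript_pr p z t)).
by rewrite [k%:R^-1 * _]mulrC mulfK ?invr_eq0.
Qed.

(** * Amplitudes and error of a protocol *)

Lemma transcript_amplitude (R : realType) (k : nat) (p : protocol R k) : (0 < k)%N ->
  exists2 s : seq bool -> 'I_k -> bool -> R, (forall t i b, 0 <= s t i b) &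
    forall t z, amplitude s t z = Num.sqrt (transcript_pr p z t).
Proof.
move=> k0.
exists (fun t i b => Num.sqrt (Pr (coins p i) (consistent (tree p) t i b))).
  by move=> *; exact: sqrtr_ge0.
move=> t z; apply/esym.
have -> : transcript_pr p z t = amplitude (fun t i b =>
    Num.sqrt (Pr (coins p i) (consistent (tree p) t i b))) t z ^+ 2.
  rewrite /amplitude -prodrXl /transcript_pr.
  rewrite [RHS](eq_bigr (fun i => Pr (coins p i) (consistent (tree p) t i (z i)))).
    2: by move=> i _; rewrite sqr_sqrtr // Pr_ge0 //; exact: coins_pmf.
  rewrite -Pr_prod; apply: eq_bigl => r; exact: board_eq.
by rewrite sqrtr_sqr ger0_norm //; apply: prodr_ge0 => i _; exact: sqrtr_ge0.
Qed.

(** Every transcript is an error for one of the two inputs. Each output class contributes at most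
    [eps] from the erring input and 1/4 from the other. *)
Lemma overlap_error (R : realType) (k : nat) (eps : R) (p : protocol R k) : (0 < k)%N ->
  eps_error eps (@AND k) p ->
  \sum_(t <- transcripts p) Num.sqrt (transcript_pr p (indicator pred0) t)
     * Num.sqrt (transcript_pr p (indicator predT) t) <= 2 * eps + 1 / 2.
Proof.
move=> k0 perr; set z0 := indicator pred0; set z1 := indicator predT.
pose P := transcript_pr p.
have P0 z t : 0 <= P z t by apply: Pr_ge0; exact: coins_law_pmf.
have A0 : AND z0 = false.
  by apply/negbTE; rewrite negb_forall; apply/existsP; exists (Ordinal k0); rewrite ffunE.
have A1 : AND z1 = true by apply/forallP => i; rewrite ffunE.
have e0 : \sum_(t <- transcripts p | output p t) P z0 t <= eps.
  rewrite sum_transcript_pr //; apply: le_trans (perr z0); rewrite A0.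
  rewrite le_eqVlt; apply/orP; left; apply/eqP.
  by apply: eq_bigl => w; rewrite inE /= eqbF_neg negbK.
have e1 : \sum_(t <- transcripts p | ~~ output p t) P z1 t <= eps.
  rewrite (sum_transcript_pr _ _ _ _ (fun t => ~~ output p t)) //.
  apply: le_trans (perr z1); rewrite A1.
  rewrite le_eqVlt; apply/orP; left; apply/eqP.
  by apply: eq_bigl => w; rewrite inE /= eqb_id.
have le1 z (A : pred (seq bool)) : \sum_(t <- transcripts p | A t) P z t <= 1.
  rewrite sum_transcript_pr // -(coins_law_pmf _ _ p).2 [leLHS]big_mkcond.
  by apply: ler_sum => r _; case: ifP => // _; exact: (coins_law_pmf _ _ p).1.
(* AM-GM, to be used with [a] the probability of an erroneous transcript *)
have amgm (a b : R) : 0 <= a -> 0 <= b -> Num.sqrt a * Num.sqrt b <= a + b / 4.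
  move=> a0 b0; rewrite -{2}(sqr_sqrtr a0) -{2}(sqr_sqrtr b0).
  have := sqr_ge0 (Num.sqrt a - Num.sqrt b / 2); lra.
rewrite (bigID (output p)) /=.
have l1 : \sum_(t <- transcripts p | output p t) Num.sqrt (P z0 t) * Num.sqrt (P z1 t)
    <= \sum_(t <- transcripts p | output p t) (P z0 t + P z1 t / 4).
  by apply: ler_sum => t _; exact: amgm.
have l2 : \sum_(t <- transcripts p | ~~ output p t) Num.sqrt (P z0 t) * Num.sqrt (P z1 t)
    <= \sum_(t <- transcripts p | ~~ output p t) (P z1 t + P z0 t / 4).
  by apply: ler_sum => t _; rewrite mulrC; exact: amgm.
move: l1 l2; rewrite !big_split -!mulr_suml /= -/P.
have := le1 z1 (fun t => output p t); have := le1 z0 (fun t => ~~ output p t); lra.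
Qed.

Theorem theorem3p2 (R : realType) (eps : R)
    (heps : eps < 3 / 10 * (1 - Num.sqrt (1 / 2 * log2 (4 / 3)))) :
  exists c : R, 0 < c /\
    forall k : nat, (1 <= k)%N ->
      ((c / k%:R)%:E <= IC eps (@AND k) (@ZD_law R k))%E.
Proof.
(* The root is at least 1/6, and [3 / 10 * (1 - 1 / 6) = 1 / 4]. *)
have eps4 : eps < 1 / 4.
  have ln43 : 1 / 4 <= ln (4 / 3 : R).
    rewrite -[4 / 3]invrK lnV ?posrE ?invr_gt0; last lra.
    have -> : (4 / 3)^-1 = 1 + - (1 / 4) :> R by field.
    by rewrite lerNr le_ln1Dx //; lra.
  have ln2 : 0 < ln 2 :> R by rewrite ln_gt0 // ltr1n.
  have log43 : (1 / 6) ^+ 2 <= 1 / 2 * log2 (4 / 3 : R).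
    have : 1 / 4 <= log2 (4 / 3 : R).
      by rewrite /log2 ler_pdivlMr //; have := ln2_le1 R; lra.
    lra.
  have : 1 / 6 <= Num.sqrt (1 / 2 * log2 (4 / 3 : R)).
    by apply: le_trans (ler_wsqrtr log43); rewrite sqrtr_sqr ger0_norm; lra.
  lra.
(* From [1 - 6 * del <= BC <= 2 * eps + 1 / 2] comes [del >= (1 / 2 - 2 * eps) / 6]; the cost keeps
   half of [del]. *)
exists ((1 / 2 - 2 * eps) / 12); split; first lra.
move=> k k0; apply/ereal_infP => _ [p /= perr <-].
rewrite lee_fin icost_ZD_law // mulrC ler_pM2l ?invr_gt0 ?ltr0n //.
have P0 z t : 0 <= transcript_pr p z t by apply: Pr_ge0; exact: coins_law_pmf.
have [s s0 sE] := transcript_amplitude _ _ p k0.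
have P1 z : \sum_(t <- transcripts p) transcript_pr p z t = 1.
  rewrite (sum_transcript_pr _ _ _ _ xpredT) // -(coins_law_pmf _ _ p).2.
  exact: eq_bigl.
have s1 z : \sum_(t <- transcripts p) amplitude s t z ^+ 2 = 1.
  by rewrite -(P1 z); apply: eq_bigr => t _; rewrite sE sqr_sqrtr.
have := overlap_zero_one_ge _ _ _ _ _ s0 s1.
have := overlap_error _ _ _ _ k0 perr.
under eq_bigr => t _ do rewrite -!sE.
set BC := \sum_(t <- _) _; set del := \sum_i _ => hBC hdel.
apply: (@le_trans _ _ (del / 2)); first lra.
rewrite mulr_suml; apply: ler_sum => d _.
apply: (@le_trans _ _ (\sum_(t <- transcripts p)
    (amplitude s t (indicator pred0) - amplitude s t (indicator (pred1 d))) ^+ 2 / 4)).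
  (* For unit vectors, [|X - Y|^2 / 4] is half of [1 - <X, Y>]. *)
  under [leRHS]eq_bigr => t _ do rewrite sqrrB.
  rewrite -mulr_suml big_split sumrB !s1 /= sumrMnl -mulr_natl; lra.
by apply: ler_sum => t _; rewrite !sE; exact: jensen_shannon_ge.
Qed.
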